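(* Let $R$ be an integral domain of characteristic zero with fraction field $K$, and let $p_i\in tR[t^2]$, $i\ge 1$, be a sequence of odd polynomials with coefficients in $R$. Define $\{u_n\}_{n\ge 0}\subseteq K$ by $u_0=1$ and the recursion \[ n u_n=\sum_{i=1}^{n} p_i\big(n-i/2\big)\,u_{n-i}\qquad\text{for } n=1,2,\dots. \] Then $u_n\in R[\tfrac12]$ for all $n\ge 0$.
   Context: Here $tR[t^2]$ denotes the set of polynomials in $R[t]$ that contain only odd powers of $t$. The values $p_i(n-i/2)$ are computed in $K$. $R[\tfrac12]$ denotes the subring of $K$ generated by $R$ and $\tfrac12$. *)

(* Defs.v *)
From mathcomp Require Import all_boot all_order all_algebra.

Set Implicit Arguments.
Unset Strict Implicit.
Unset Printing Implicit Defensive.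

Import GRing.Theory.
Local Open Scope ring_scope.

(* p lies in t R[t^2]. *)
Definition odd_powers_only (R : nzRingType) (p : {poly R}) : Prop :=
  forall k : nat, p`_k != 0 -> odd k.

(* Prop-valued, since membership in a generated subring need not be
   decidable. *)
Inductive subring_generated (K : nzRingType) (A : K -> Prop) : K -> Prop :=
| subring_gen_mem x : A x -> subring_generated A x
| subring_gen_one : subring_generated A 1
| subring_gen_sub x y :
    subring_generated A x -> subring_generated A y ->
    subring_generated A (x - y)
| subring_gen_mul x y :
    subring_generated A x -> subring_generated A y ->
    subring_generated A (x * y).

(* R[1/2] as a subring of Frac(R). *)
Definition in_adjoin_half (R : idomainType) (x : {fraction R}) : Prop :=
  subring_generated
    (fun y : {fraction R} => (exists r : R, y = tofrac r) \/ y = 2^-1) x.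

(* Main.v *)
(** With [D = x d/dx], the generating function [U] of [u] satisfies
    [(D - \sum_i x^(i/2) p_i(D) x^(i/2)) U = 0]. As the [p_i] are odd, this
    operator [L] is anti-self-adjoint for [x^* = x], [D^* = - D]. Work over
    the localization [S] of [R] at an odd prime [p]. If [p] does not divide
    [d], a congruence [(1 + B)^* L (1 + B)] with [B] homogeneous of degree [d]
    removes the degree [d] part of [L], since [[D, B] = d B]; it keeps [L]
    anti-self-adjoint and changes solutions by the integral operator [1 + B].
    Once only degrees divisible by [p] are left, [L] acts on series in
    [y = x^p], and oddness makes its coefficients divisible by [p]: dividing
    by [p] gives an operator of the same kind in [y], whose solution is needed
    only to a lower order. Operators are represented by their matrices, and
    polynomiality in [D] is weakened to a Lipschitz condition along the
    diagonals. *)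

Require Import Defs.
From mathcomp Require Import all_boot all_order all_algebra.
From mathcomp Require Import zify ring.

Set Implicit Arguments.
Unset Strict Implicit.
Unset Printing Implicit Defensive.

Import GRing.Theory.
Local Open Scope ring_scope.

(** * Lipschitz functions from the integers to a subring *)

Section Lipschitz.

Variables (K : fieldType) (S : K -> Prop).
Hypotheses (S1 : S 1) (SB : forall x y, S x -> S y -> S (x - y))
  (SM : forall x y, S x -> S y -> S (x * y)).

Lemma subring0 : S 0.
Proof. by rewrite -(subrr 1); apply: SB. Qed.

Lemma subringN x : S x -> S (- x).
Proof. by move=> Sx; rewrite -sub0r; apply: SB => //; apply: subring0. Qed.

Lemma subringD x y : S x -> S y -> S (x + y).
Proof. by move=> Sx Sy; rewrite -(opprK y); apply/SB/subringN. Qed.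

Lemma subring_nat n : S n%:R.
Proof.
by elim: n => [|n IHn]; [apply: subring0 | rewrite -natr1; apply: subringD].
Qed.

Lemma subring_int (m : int) : S m%:~R.
Proof.
by case: m => n; [|rewrite NegzE mulrNz; apply: subringN]; apply: subring_nat.
Qed.

(** Of polynomiality only the congruences modulo [h S] are kept: they are stable under sums and
    products, and suffice for the later division by a prime. *)
Definition lipschitz (f : int -> K) : Prop :=
  (forall a, S (f a)) /\
  (forall a h, exists2 s, S s & f (a + h) - f a = h%:~R * s).

Lemma eq_lipschitz f g : f =1 g -> lipschitz f -> lipschitz g.
Proof.
move=> fg [Sf lf]; split=> [a|a h]; first by rewrite -fg.
by have [s Ss e] := lf a h; exists s; rewrite // -!fg.
Qed.

Lemma lipschitz_cst c : S c -> lipschitz (fun=> c).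
Proof.
move=> Sc; split=> // a h; exists 0; last by rewrite subrr mulr0.
exact: subring0.
Qed.

Lemma lipschitzD f g :
  lipschitz f -> lipschitz g -> lipschitz (fun h => f h + g h).
Proof.
move=> [Sf lf] [Sg lg]; split=> [a|a h]; first exact: subringD.
have [s Ss es] := lf a h; have [t St et] := lg a h.
by exists (s + t); [apply: subringD | rewrite mulrDr -es -et; ring].
Qed.

Lemma lipschitzM f g :
  lipschitz f -> lipschitz g -> lipschitz (fun h => f h * g h).
Proof.
move=> [Sf lf] [Sg lg]; split=> [a|a h]; first exact: SM.
have [s Ss es] := lf a h; have [t St et] := lg a h.
exists (s * g (a + h) + f a * t); first by apply: subringD; apply: SM.
by rewrite mulrDr mulrA -es [_ * (f a * t)]mulrCA -et; ring.
Qed.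

Lemma lipschitzN f : lipschitz f -> lipschitz (fun h => - f h).
Proof.
move=> lf; apply: (@eq_lipschitz (fun h => -1 * f h)) => [h|].
  by rewrite mulN1r.
by apply: lipschitzM lf; apply/lipschitz_cst/subringN.
Qed.

Lemma lipschitz_sum n (F : 'I_n -> int -> K) :
  (forall i, lipschitz (F i)) -> lipschitz (fun h => \sum_i F i h).
Proof.
elim: n F => [|n IHn] F lF.
  apply: (@eq_lipschitz (fun=> 0)) => [h|]; first by rewrite big_ord0.
  exact/lipschitz_cst/subring0.
apply: (@eq_lipschitz (fun h => F ord0 h + \sum_i F (lift ord0 i) h)) => [h|].
  by rewrite big_ord_recl.
exact/lipschitzD/IHn.
Qed.

Lemma lipschitz_horner (q : {poly K}) c :
  (forall i, S q`_i) -> S c -> lipschitz (fun h => q.[c + h%:~R]).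
Proof.
move=> Sq Sc.
apply: (@eq_lipschitz (fun h => \sum_(i < size q) q`_i * (c + h%:~R) ^+ i)).
  by move=> h; rewrite horner_coef.
apply: lipschitz_sum => i; apply: lipschitzM; first exact: lipschitz_cst.
have lX : lipschitz (fun h => c + h%:~R).
  split=> [a|a h]; first by apply: subringD => //; apply: subring_int.
  by exists 1; rewrite // intrD; ring.
elim: (i : nat) => [|n IHn]; first exact: lipschitz_cst.
apply: (eq_lipschitz _ (lipschitzM lX IHn)) => h.
by rewrite exprS.
Qed.

(** * Skew kernels and removal of one diagonal *)

(* [L] is the matrix of the operator [x^b |-> \sum_a L a b x^a]; its adjoint has
   matrix [L (- b) (- a)]. *)
Record skew_kernel (L : int -> int -> K) : Prop := SkewKernel {
  skew_tri : forall a b : int, (a < b)%R -> L a b = 0;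
  skew_diag : forall a, L a a = a%:~R;
  skew_lip : forall a b, lipschitz (fun h => L (a + h) (b + h));
  skew_anti : forall a b, L (- b) (- a) = - L a b }.

Lemma skew_in L a b : skew_kernel L -> S (L a b).
Proof. by move=> /skew_lip/(_ a b)[/(_ 0)]; rewrite !addr0. Qed.

(* [(1 + B)^* L (1 + B)], where [B] is supported on [a - b = d] and equals
   [- L / d] there. *)
Definition eliminate (d : nat) (L : int -> int -> K) (a b : int) : K :=
  let g c := L c (c - d%:Z) / d%:R in
  (L a b - L a (b + d%:Z) * g (b + d%:Z)) +
  g a * (L (a - d%:Z) b - L (a - d%:Z) (b + d%:Z) * g (b + d%:Z)).

(** By triangularity the correction terms only reach degrees at least [d]. *)
Lemma eliminate_low d e L (b : int) : skew_kernel L -> (e < d)%N ->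
  eliminate d L (b + e%:Z) b = L (b + e%:Z) b.
Proof.
move=> kL lt_ed; rewrite /eliminate.
have -> : L (b + e%:Z) (b + d%:Z) = 0 by apply: (skew_tri kL); lia.
have -> : L (b + e%:Z - d%:Z) b = 0 by apply: (skew_tri kL); lia.
have -> : L (b + e%:Z - d%:Z) (b + d%:Z) = 0 by apply: (skew_tri kL); lia.
by rewrite !mul0r subrr mulr0 addr0 subr0.
Qed.

(** The diagonal entries [b + d] and [b] contribute [- d] times [g (b + d)], which cancels the
    entry. *)
Lemma eliminate_at d L (b : int) :
  skew_kernel L -> d%:R != 0 :> K -> (0 < d)%N ->
  eliminate d L (b + d%:Z) b = 0.
Proof.
move=> kL d_neq0 d_gt0; rewrite /eliminate addrK.
rewrite (skew_tri kL (a := b) (b := b + d%:Z)); last by lia.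
by rewrite !skew_diag // intrD; field.
Qed.

Lemma eliminate_skew d L : skew_kernel L -> (0 < d)%N -> S d%:R^-1 ->
  skew_kernel (eliminate d L).
Proof.
move=> kL d_gt0 Sd; split.
- move=> a b lt_ab; rewrite /eliminate.
  rewrite (skew_tri kL lt_ab).
  have -> : L a (b + d%:Z) = 0 by apply: (skew_tri kL); lia.
  have -> : L (a - d%:Z) b = 0 by apply: (skew_tri kL); lia.
  have -> : L (a - d%:Z) (b + d%:Z) = 0 by apply: (skew_tri kL); lia.
  by rewrite !mul0r subrr mulr0 addr0.
- move=> a; have := @eliminate_low d 0 L a kL d_gt0; rewrite addr0 => ->.
  exact: skew_diag.
- move=> a b; rewrite /eliminate.
  have lL a' b' c e : (forall h, c h = a' + h) -> (forall h, e h = b' + h) ->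
      lipschitz (fun h => L (c h) (e h)).
    move=> cE eE; apply: eq_lipschitz (skew_lip kL a' b') => h.
    by rewrite cE eE.
  have lg a' c : (forall h, c h = a' + h) ->
      lipschitz (fun h => L (c h) (c h - d%:Z) / d%:R).
    move=> cE; apply: lipschitzM; last exact: lipschitz_cst.
    by apply: (lL a' (a' - d%:Z)) => // h; rewrite cE addrAC.
  have l1 : lipschitz (fun h => L (b + h + d%:Z) (b + h + d%:Z - d%:Z) / d%:R).
    by apply: (lg (b + d%:Z)) => h; rewrite addrAC.
  apply: lipschitzD; [|apply: lipschitzM].
  + apply: lipschitzD; first exact: (lL a b).
    apply/lipschitzN/lipschitzM => //.
    by apply: (lL a (b + d%:Z)) => // h; rewrite addrAC.
  + exact: (lg a).
  + apply: lipschitzD.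
      by apply: (lL (a - d%:Z) b) => // h; rewrite addrAC.
    apply/lipschitzN/lipschitzM => //.
    by apply: (lL (a - d%:Z) (b + d%:Z)) => h; rewrite addrAC.
- move=> a b; rewrite /eliminate.
  (* Reflection turns [g (- b)] into [- g (b + d)], that is [B^* = - B], so the row and column
     corrections change places. *)
  rewrite !addrK.
  have -> : - a + d%:Z = - (a - d%:Z) by ring.
  have -> : - b - d%:Z = - (b + d%:Z) by ring.
  by rewrite !(skew_anti kL); ring.
Qed.

(** The factor [(1 + B)^*] is unipotent and lower triangular, so it cancels row by row; what remains
    is [L] applied to [(1 + B) v]. *)
Lemma eliminate_solution d L M (v : nat -> K) : skew_kernel L -> (0 < d)%N ->
  (forall a, (a < M)%N -> \sum_(0 <= b < M) eliminate d L a b * v b = 0) ->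
  forall a, (a < M)%N ->
  \sum_(0 <= b < M) L a b *
    (v b - (if (d <= b)%N
            then L b (b%:Z - d%:Z) / d%:R * v (b - d)%N else 0)) = 0.
Proof.
move=> kL d_gt0 Lv.
pose g c := L c (c - d%:Z) / d%:R.
pose G (a : int) := \sum_(0 <= b < M)
  (L a b%:Z - L a (b%:Z + d%:Z) * g (b%:Z + d%:Z)) * v b.
(* [G a] is row [a] of [L (1 + B) v]. The hypothesis reads [G a + g a * G (a - d) = 0], and [G]
   vanishes at negative indices. *)
have G0 (a : nat) : (a < M)%N -> G a = 0.
  elim/ltn_ind: a => a IHa lt_aM; have := Lv a lt_aM.
  rewrite (eq_big_nat _ _ (F2 := fun b : nat =>
     (L a b%:Z - L a (b%:Z + d%:Z) * g (b%:Z + d%:Z)) * v b +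
     g a * ((L (a%:Z - d%:Z) b%:Z -
             L (a%:Z - d%:Z) (b%:Z + d%:Z) * g (b%:Z + d%:Z)) * v b)));
    last by move=> b _; rewrite /eliminate -/(g _) -/(g _) mulrDl -mulrA.
  rewrite big_split /= -mulr_sumr -/(G a) -/(G (a%:Z - d%:Z)).
  suff -> : G (a%:Z - d%:Z) = 0 by rewrite mulr0 addr0.
  case: (leqP d a) => [le_da|lt_ad].
    by rewrite subzn // IHa //; lia.
  rewrite /G big1_seq // => b _.
  by rewrite !(skew_tri kL _) ?mul0r ?subr0 ?mul0r //; lia.
move=> a lt_aM; rewrite -[RHS](G0 a lt_aM) /G.
under eq_bigr do rewrite mulrBr.
under [in RHS]eq_bigr do rewrite mulrBl.
rewrite !sumrB; congr (_ - _).
(* Shift the index by [d]; the terms with [M <= b] lie above the diagonal. *)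
transitivity (\sum_(d <= b < M + d)
    L a b * (L b (b%:Z - d%:Z) / d%:R * v (b - d)%N)).
  transitivity (\sum_(0 <= b < M + d) L a b * (if (d <= b)%N
      then L b (b%:Z - d%:Z) / d%:R * v (b - d)%N else 0)).
    rewrite [in RHS](@big_cat_nat _ _ _ M) //=; last exact: leq_addr.
    rewrite [X in _ + X]big_nat_cond [X in _ + X]big1 ?addr0 // => b.
    by rewrite andbT => /andP[leMb _]; rewrite (skew_tri kL) ?mul0r //; lia.
  rewrite (@big_cat_nat _ _ _ d) //=; last exact: leq_addl.
  rewrite [X in X + _]big_nat_cond [X in X + _]big1 ?add0r => [|b].
    by apply: eq_big_nat => b /andP[-> _].
  by case/andP => /andP[_ lt_bd] _; rewrite leqNgt lt_bd mulr0.
rewrite -{1}[d]add0n big_addn addnK; apply: eq_bigr => b _.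
by rewrite addnK /g PoszD mulrA.
Qed.

(** * Rescaling by an odd prime, and integral solutions *)

Lemma sum_multiples q m (F : nat -> K) : (0 < q)%N ->
  \sum_(0 <= b < q * m | (q %| b)%N) F b = \sum_(0 <= c < m) F (q * c)%N.
Proof.
move=> q_gt0; elim: m => [|m IHm]; first by rewrite muln0 !big_geq.
rewrite mulnS addnC (@big_cat_nat _ _ _ (q * m)) ?leq_addr //= IHm.
rewrite big_nat_recr //=; congr (_ + _).
have lt_q : (q * m < q * m + q)%N by lia.
rewrite big_ltn_cond // dvdn_mulr //.
rewrite big_nat_cond big1 ?addr0 // => b /andP[/andP[lt1 lt2] /dvdnP[k eb]].
exfalso; move: lt1 lt2; rewrite eb -mulnSr ![(q * _)%N]mulnC !ltn_pmul2r //.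
by lia.
Qed.

Variable (p : nat).
Hypotheses (p_pr : prime p) (p_odd : odd p).
Hypothesis natK_neq0 : forall n, (0 < n)%N -> n%:R != 0 :> K.
Hypothesis SV : forall m, ~~ (p %| m)%N -> S m%:R^-1.

(** This is the operator in [y = x^p], divided by [p]. Integrality comes from [p] dividing twice an
    entry, 2 being invertible in [S] as [p] is odd. *)
Lemma rescale_skew L : skew_kernel L ->
  skew_kernel (fun a b => L (p%:Z * a) (p%:Z * b) / p%:R).
Proof.
move=> kL; have p_gt0 := prime_gt0 p_pr; have p_neq0 := natK_neq0 p_gt0.
have p_gt2 : (2 < p)%N by case: p p_pr p_odd => [|[|[|]]].
split.
- move=> a b lt_ab; rewrite (skew_tri kL) ?mul0r //; nia.
- by move=> a; rewrite skew_diag // intrM mulrC mulKf.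
- move=> a b; split=> [h|c h].
    (* [L A B] and [L (- B) (- A) = - L A B] are congruent modulo [p]. *)
    set A := p%:Z * _; set B := p%:Z * _.
    have [_ /(_ 0 (- (A + B)))[s Ss]] := skew_lip kL A B.
    rewrite !addr0 add0r.
    have -> : A + - (A + B) = - B by ring.
    have -> : B + - (A + B) = - A by ring.
    rewrite (skew_anti kL) /A /B -mulrDr intrN intrM => e.
    suff -> : L A B / p%:R = 2%:R^-1 * ((a + h + (b + h))%:~R * s).
      apply: SM; last by apply: SM => //; apply: subring_int.
      by apply: SV; rewrite gtnNdvd.
    have two_neq0 : 2%:R != 0 :> K by apply: natK_neq0.
    apply: (mulfI two_neq0); apply: (mulIf p_neq0).
    rewrite mulVKf // mulrA mulfVK // /A /B.
    apply: oppr_inj.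
    transitivity (- (p%:R * (a + h + (b + h))%:~R) * s); last by ring.
    by rewrite pmulrn -e; ring.
  (* A shift by [h] is a shift by [p h] in [L]; the factor [p] absorbs the division. *)
  have [_ /(_ (p%:Z * c) (p%:Z * h))[s Ss e]] :=
    skew_lip kL (p%:Z * a) (p%:Z * b).
  exists s => //; rewrite !mulrDr !addrA -mulrBl.
  by move: e; rewrite !addrA => ->; rewrite intrM -pmulrn; field.
- by move=> a b; rewrite !mulrN (skew_anti kL) mulNr.
Qed.

(** Induction on the truncation order: clear the degrees prime to [p], rescale, and lift a solution
    of smaller order. *)
Lemma skew_solution M L : skew_kernel L ->
  exists v : nat -> K, [/\ v 0%N = 1, forall n, S (v n) &
    forall a, (a < M)%N -> \sum_(0 <= b < M) L a b * v b = 0].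
Proof.
have p_gt0 := prime_gt0 p_pr.
have p_gt1 := prime_gt1 p_pr.
elim: M L => [|M IHM] L kL; first by exists (fun=> 1); split.
have [M0|M_gt0] := posnP M.
  exists (fun=> 1); split=> // a; rewrite M0 ltnS leqn0 => /eqP ->.
  by rewrite big_nat1 skew_diag // mul0r.
(* Degrees below [d] have been treated; [k] counts those left below [M.+1]. *)
suff elim_upto k d L' : (d + k = M.+1)%N -> skew_kernel L' ->
    (forall (b : int) e, (e < d)%N -> ~~ (p %| e)%N -> L' (b + e%:Z) b = 0) ->
    exists v : nat -> K, [/\ v 0%N = 1, forall n, S (v n) &
      forall a, (a < M.+1)%N -> \sum_(0 <= b < M.+1) L' a b * v b = 0].
  exact: (elim_upto M.+1 0%N).
elim: k d L' {L kL} => [|k IHk] d L.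
  rewrite addn0 => -> kL L0.
  have [v [v0 Sv Lv]] := IHM _ (rescale_skew kL).
  exists (fun n => if (p %| n)%N then v (n %/ p)%N else 0); split.
  - by rewrite dvdn0 div0n.
  - by move=> n; case: ifP => // _; apply: subring0.
  (* In a row prime to [p], a column divisible by [p] has degree prime to [p], where [L]
     vanishes. *)
  move=> a lt_aM; have [/dvdnP[m am]|pNa] := boolP (p %| a)%N; last first.
    rewrite big_nat_cond big1 // => b /andP[/andP[_ lt_bM] _].
    case: ifP => [pb|_]; last by rewrite mulr0.
    have [lt_ab|le_ba] := ltnP a b;
      first by rewrite (skew_tri kL) ?mul0r //; lia.
    have {1}-> : a%:Z = b%:Z + (a - b)%N%:Z by lia.
    by rewrite L0 ?mul0r ?dvdn_subl //; lia.
  have lt_mM : (m < M)%N by nia.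
  transitivity (\sum_(0 <= b < p * M | (p %| b)%N) L a b * v (b %/ p)%N).
    have le_M : (M.+1 <= p * M)%N by nia.
    rewrite [in RHS](@big_cat_nat _ _ _ M.+1) //= [X in _ + X]big_nat_cond.
    rewrite [X in _ + X]big1 ?addr0 => [|b /andP[/andP[ltMb _] _]].
      rewrite [RHS]big_mkcond; apply: eq_bigr => b _.
      by case: ifP; rewrite ?mulr0.
    by rewrite (skew_tri kL) ?mul0r //; lia.
  rewrite sum_multiples // -[RHS](mulr0 p%:R) -[in RHS](Lv m lt_mM) mulr_sumr.
  apply: eq_bigr => c _; rewrite mulKn // am [(m * p)%N]mulnC !PoszM.
  by rewrite mulrA [p%:R * _]mulrC mulfVK // natK_neq0.
move=> dk kL L0; have [pd|pNd] := boolP (p %| d)%N.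
  apply: (IHk d.+1) => //; first by rewrite addSnnS.
  move=> b e; rewrite ltnS leq_eqVlt => /orP[/eqP->|]; first by rewrite pd.
  exact: L0.
have d_gt0 : (0 < d)%N by case: d pNd {dk L0}; rewrite ?dvdn0.
have [||b e|v [v0 Sv Lv]] := IHk d.+1 (eliminate d L).
- by rewrite addSnnS.
- by apply: eliminate_skew => //; apply: SV.
- rewrite ltnS leq_eqVlt => /orP[/eqP-> _|lt_ed pNe].
    by rewrite eliminate_at // natK_neq0.
  by rewrite eliminate_low // L0.
(* This is [(1 + B) v], with the constant term of [v] because [0 < d]. *)
exists (fun b => v b - (if (d <= b)%N
  then L b (b%:Z - d%:Z) / d%:R * v (b - d)%N else 0)); split.
- by rewrite leqNgt d_gt0 subr0.
- move=> n; apply: SB => //; case: ifP => _; last exact: subring0.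
  by do 2![apply: SM => //]; [apply: skew_in | apply: SV].
- exact: eliminate_solution.
Qed.

(** * The recursion over a localization *)

(** The recursion says [L u = 0], and [u 0] determines its solution since positive integers are
    nonzero in [K]; hence [u] agrees with the integral solution. *)
Lemma odd_recursion_local (P : nat -> {poly K}) (u : nat -> K) :
  (forall i k, S (P i)`_k) ->
  (forall i x, (0 < i)%N -> (P i).[- x] = - (P i).[x]) ->
  u 0%N = 1 ->
  (forall n, (0 < n)%N -> n%:R * u n =
     \sum_(1 <= i < n.+1) (P i).[n%:R - i%:R / 2] * u (n - i)%N) ->
  forall n, S (u n).
Proof.
move=> SP Podd u0 u_rec n.
have two_neq0 : 2%:R != 0 :> K by apply: natK_neq0.
have S2 : S 2%:R^-1.
  by apply: SV; rewrite gtnNdvd //; case: p p_pr p_odd => [|[|[|]]].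
(* The argument [n - i/2] is the midpoint of row [n] and column [n - i]. The midpoint changes sign
   under reflection, so oddness of [P] gives skewness. *)
pose L (a b : int) : K := if (a < b)%R then 0 else if a == b then a%:~R else
  - (P `|(a - b)%R|%N).[(a + b)%:~R / 2].
have kL : skew_kernel L.
  split.
  - by move=> a b; rewrite /L => ->.
  - by move=> a; rewrite /L Order.POrderTheory.ltxx eqxx.
  - move=> a b; rewrite /L; case: (Order.TotalTheory.ltgtP a b) => ab.
    + apply: (@eq_lipschitz (fun=> 0)); last exact/lipschitz_cst/subring0.
      by move=> h; rewrite ifT //; lia.
    + apply: (@eq_lipschitz
        (fun h => - (P `|(a - b)%R|%N).[(a + b)%:~R / 2 + h%:~R])).
        move=> h; rewrite ifF; last by lia.
        rewrite ifF; last by lia.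
        congr (- horner (polyseq (P (absz _))) _); first by ring.
        by rewrite !intrD; field.
      apply/lipschitzN/lipschitz_horner => //; apply: SM => //.
      exact: subring_int.
    + rewrite ab; apply: (@eq_lipschitz (fun h => (b + h)%:~R)).
        by move=> h; rewrite Order.POrderTheory.ltxx eqxx.
      split=> [c|c h]; first exact: subring_int.
      by exists 1; rewrite // !intrD; ring.
  - move=> a b; rewrite /L.
    have -> : (- b < - a)%R = (a < b)%R by lia.
    have -> : (- b == - a) = (a == b) by lia.
    case: ifP => ab; first by rewrite oppr0.
    case: eqVneq => [->|neq]; first by rewrite intrN.
    have -> : - b - - a = a - b by ring.
    rewrite opprK -Podd; last by lia.
    congr (horner _ _).
    by rewrite -mulNr -intrN; congr (_%:~R / _); ring.
have [v [v0 Sv Lv]] := @skew_solution n.+1 L kL.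
suff uv m : (m <= n)%N -> u m = v m by rewrite uv.
elim/ltn_ind: m => m IHm le_mn; have [->|m_gt0] := posnP m; first by rewrite u0.
apply: (mulfI (natK_neq0 m_gt0)); rewrite u_rec //.
have := Lv m le_mn; rewrite (@big_cat_nat _ _ _ m.+1) //=.
rewrite [X in _ + X]big_nat_cond [X in _ + X]big1 ?addr0; last first.
  move=> b /andP[/andP[lt_mb _] _]; rewrite (skew_tri kL) ?mul0r //; lia.
rewrite big_nat_recr //= skew_diag // -pmulrn addrC => /(canRL (addrK _)) ->.
(* Reverse the sum, so that [i = m - b]. *)
rewrite sub0r -sumrN big_add1 /= big_nat_rev add0n.
apply: eq_big_nat => b /= lt_bm.
have -> : (m - b.+1).+1 = (m - b)%N by lia.
rewrite subKn 1?ltnW // IHm //; last by lia.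
rewrite /L ifF; last by lia.
rewrite ifF; last by lia.
rewrite mulNr opprK; congr (horner (P _) _ * _); first by lia.
rewrite natrB 1?ltnW // intrD -!pmulrn; field; exact: two_neq0.
Qed.

End Lipschitz.

(** * From the localizations to [R[1/2]] *)

Lemma adjoin_half_of_local (R : idomainType) (x : {fraction R}) :
  (forall p, prime p -> odd p -> exists m : nat, ~~ (p %| m)%N /\
     exists r : R, m%:R * x = tofrac r) ->
  (2%:R != 0 :> {fraction R}) ->
  in_adjoin_half x.
Proof.
move=> loc two_neq0.
(* The [m] with [m x] in [R[1/2]] form an ideal of the integers; it is not
   contained in [(q)] for any odd prime [q]. *)
suff dec m : (0 < m)%N -> in_adjoin_half (m%:R * x) -> in_adjoin_half x.
  (* Any odd prime would give a first positive multiplier. *)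
  have [//|//|m [m3 [r e]]] := loc 3.
  apply: (dec m); first by case: m m3 {e}.
  by rewrite e; apply: subring_gen_mem; left; exists r.
elim/ltn_ind: m => m IHm m_gt0 Amx.
have [m_le1|m_gt1] := leqP m 1.
  have m1 : m = 1%N by lia.
  by move: Amx; rewrite m1 mul1r.
have q_pr := pdiv_prime m_gt1; have q_dvd := pdiv_dvd m.
set q := pdiv m in q_pr q_dvd.
(* Descent on [m]: a factor 2 is divided out; for odd [q], a multiplier prime to [q] has with [m] a
   gcd smaller than [m], reached by Bezout. *)
have [q2|q_odd] := even_prime q_pr.
  have [k mk] := dvdnP q_dvd; rewrite q2 in mk.
  apply: (IHm k); [by lia | by lia |].
  have -> : k%:R * x = 2^-1 * (m%:R * x) by rewrite mk natrM; field.
  by apply: subring_gen_mul => //; apply: subring_gen_mem; right.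
have [m' [qm' [r e]]] := loc q q_pr q_odd.
have Am'x : in_adjoin_half (m'%:R * x).
  by rewrite e; apply: subring_gen_mem; left; exists r.
case: (egcdnP m' m_gt0) => km kn eg _.
have gcd_gt0 : (0 < gcdn m m')%N by rewrite gcdn_gt0 m_gt0.
apply: (IHm (gcdn m m')) => //.
  have : (gcdn m m' <= m)%N by rewrite dvdn_leq ?dvdn_gcdl.
  rewrite leq_eqVlt => /orP[/eqP gm|//].
  by move: qm'; rewrite (dvdn_trans q_dvd) // -gm dvdn_gcdr.
have Anat k : in_adjoin_half (k%:R : {fraction R}).
  by apply: subring_gen_mem; left; exists k%:R; rewrite rmorph_nat.
have -> : (gcdn m m')%:R * x = km%:R * (m%:R * x) - kn%:R * (m'%:R * x).
  by rewrite !mulrA -!natrM eg natrD; ring.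
apply: subring_gen_sub; apply: subring_gen_mul.
- exact: Anat.
- exact: Amx.
- exact: Anat.
- exact: Am'x.
Qed.

Theorem theorem2 (R : idomainType) (charR0 : [pchar R] =i pred0)
    (p : nat -> {poly R})
    (p_odd : forall i : nat, (1 <= i)%N -> odd_powers_only (p i))
    (u : nat -> {fraction R})
    (u0 : u 0%N = 1)
    (u_rec : forall n : nat, (1 <= n)%N ->
      n%:R * u n =
      \sum_(1 <= i < n.+1)
        (map_poly (@tofrac R) (p i)).[n%:R - i%:R / 2] * u (n - i)%N) :
  forall n : nat, in_adjoin_half (u n).
Proof.
move=> n.
have natK_neq0 k : (0 < k)%N -> k%:R != 0 :> {fraction R}.
  move=> k_gt0; rewrite -(rmorph_nat (@tofrac R)) tofrac_eq0.
  by rewrite ((pcharf0P R).1 charR0) -lt0n.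
apply: adjoin_half_of_local; last exact: natK_neq0.
move=> q q_pr q_odd.
(* [S] is [R] with the integers prime to [q] inverted. *)
pose S (x : {fraction R}) := exists m : nat, ~~ (q %| m)%N /\
     exists r : R, m%:R * x = tofrac r.
have q1 : ~~ (q %| 1)%N by rewrite dvdn1; case: q q_pr {q_odd S} => [|[]].
have Sfrac (r : R) : S (tofrac r).
  by exists 1%N; split=> //; exists r; rewrite mul1r.
apply: (@odd_recursion_local _ S _ _ _ q q_pr q_odd natK_neq0 _
  (fun i => map_poly (@tofrac R) (p i))) => //.
- by rewrite -tofrac1.
- move=> x y [m [qm [r er]]] [l [ql [s es]]]; exists (m * l)%N.
  split; first by rewrite Euclid_dvdM // negb_or qm.
  exists (l%:R * r - m%:R * s).
  by rewrite tofracB !tofracM !(rmorph_nat (@tofrac R)) -er -es natrM; ring.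
- move=> x y [m [qm [r er]]] [l [ql [s es]]]; exists (m * l)%N.
  split; first by rewrite Euclid_dvdM // negb_or qm.
  by exists (r * s); rewrite tofracM -er -es natrM; ring.
- move=> m qm; exists m; split=> //; exists 1; rewrite tofrac1 mulfV //.
  by apply: natK_neq0; case: m qm; rewrite ?dvdn0.
- by move=> i k; rewrite coef_map; apply: Sfrac.
- move=> i x i_gt0; rewrite !horner_coef -sumrN; apply: eq_bigr => k _.
  rewrite coef_map /=; have [->|nz] := eqVneq (p i)`_k 0.
    by rewrite tofrac0 !mul0r oppr0.
  by rewrite exprNn -signr_odd (p_odd i i_gt0 k nz) expr1 mulN1r mulrN.
Qed.
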